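(* Let $P>0$ and $\bar R>0$. For the anti-symmetric Gaussian primitive diamond channel (i.e. $\alpha=1$, $\beta=-1$, $R_1=R_2=\bar R$, perfectly correlated noises), the cut-set upper bound, the decode-forward (DF) lower bound and the hybrid MQ-DF lower bound, defined in the context, are given by $$\mathrm{Cutset}_{\mathrm{sym},\diamond}(\bar R)=\begin{cases}\bar R+\psi(P),&\psi(P)<\bar R,\\ 2\bar R,&\psi(P)\ge\bar R,\end{cases}$$ $$R_{\mathrm{sym},\diamond,\mathrm{DF}}(\bar R)=\begin{cases}\psi(P),&\psi(P)<2\bar R,\\ 2\bar R,&\psi(P)\ge2\bar R,\end{cases}$$ $$R_{\mathrm{sym},\diamond,\mathrm{MQ\text{-}DF}}(\bar R)=\begin{cases}\bar R+\frac{\psi(P)}2,&\psi(P)<2\bar R,\\ 2\bar R,&\psi(P)\ge2\bar R.\end{cases}$$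
   Context: All logarithms are base 2, $\psi(x)=\frac12\log(1+x)$, $\bar\gamma=1-\gamma$, $R_{\min}=\min(R_1,R_2)$. For the Gaussian primitive diamond channel with perfectly correlated noises (relays observing $Y_1=\alpha X+Z$ and $Y_2=\beta X+Z$ with common $Z\sim\mathcal N(0,1)$, input power $P$, and noiseless links of capacities $R_1,R_2$ to the receiver), with $|\alpha|\ge|\beta|$, $\alpha\neq\beta$, the bounds are defined by $$\mathrm{Cutset}_\diamond(R_1,R_2)=\min\{R_1+R_2,\ R_1+\psi(\beta^2P),\ R_2+\psi(\alpha^2P)\},$$ $$R_{\diamond,\mathrm{DF}}(R_1,R_2)=\max_{\gamma\in[0,1]}\min\left\{R_1+R_2,\ R_1+\psi\!\left(\tfrac{\bar\gamma\beta^2P}{\gamma\beta^2P+1}\right),\ \psi(\gamma\alpha^2P)+\psi\!\left(\tfrac{\bar\gamma\beta^2P}{\gamma\beta^2P+1}\right)\right\},$$ $$R_{\diamond,\mathrm{MQ\text{-}DF}}(R_1,R_2)=\max_{\gamma\in[0,1],\,\rho\in[0,R_{\min}]}\min\left\{R_1+R_2-\rho,\ R_1+\psi\!\left(\tfrac{\bar\gamma\beta^2P}{\gamma\beta^2P+1}\right),\ \psi(\gamma\alpha^2P)+\psi\!\left(\tfrac{\bar\gamma\beta^2P}{\gamma\beta^2P+1}\right)+\rho\right\}.$$ The quantities $\mathrm{Cutset}_{\mathrm{sym},\diamond}(\bar R)$, $R_{\mathrm{sym},\diamond,\mathrm{DF}}(\bar R)$, $R_{\mathrm{sym},\diamond,\mathrm{MQ\text{-}DF}}(\bar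 R)$ are these three expressions evaluated at $R_1=R_2=\bar R$, $\alpha=1$, $\beta=-1$. *)

(* Defs.v *)
From HB Require Import structures.
From mathcomp Require Import all_boot all_order all_algebra.
From mathcomp Require Import all_classical all_reals all_analysis.
Set Implicit Arguments.
Unset Strict Implicit.
Unset Printing Implicit Defensive.
Import Order.TTheory GRing.Theory Num.Theory.
Local Open Scope classical_set_scope.
Local Open Scope ring_scope.

(* A maximum, as opposed to a supremum: the value must be attained. *)
Definition is_max (R : realType) (A : set R) (m : R) : Prop :=
  A m /\ ubound A m.

Definition log2 (R : realType) (x : R) : R := ln x / ln 2.

Definition psi (R : realType) (x : R) : R := 2^-1 * log2 (1 + x).

(* Gaussian primitive diamond channel with perfectly correlated noises:
   Y1 = alpha X + Z and Y2 = beta X + Z with the same Z ~ N(0, 1), input power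
   P, noiseless relay-to-receiver links of capacities R1 and R2.  The formulas
   below are meant for |alpha| >= |beta| and alpha <> beta. *)

Definition cutset (R : realType) (alpha beta P R1 R2 : R) : R :=
  Num.min (R1 + R2)
    (Num.min (R1 + psi (beta ^+ 2 * P)) (R2 + psi (alpha ^+ 2 * P))).

(* psi(SINR) at the second relay when the fraction gamma of the power is
   treated there as noise. *)
Definition psi_weak (R : realType) (beta P gamma : R) : R :=
  psi (((1 - gamma) * beta ^+ 2 * P) / (gamma * beta ^+ 2 * P + 1)).

Definition DF_rate (R : realType) (alpha beta P R1 R2 gamma : R) : R :=
  Num.min (R1 + R2)
    (Num.min (R1 + psi_weak beta P gamma)
             (psi (gamma * alpha ^+ 2 * P) + psi_weak beta P gamma)).

Definition is_DF_bound (R : realType) (alpha beta P R1 R2 v : R) : Prop :=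
  is_max [set DF_rate alpha beta P R1 R2 gamma | gamma in `[0, 1]] v.

Definition MQDF_rate (R : realType) (alpha beta P R1 R2 gamma rho : R) : R :=
  Num.min (R1 + R2 - rho)
    (Num.min (R1 + psi_weak beta P gamma)
             (psi (gamma * alpha ^+ 2 * P) + psi_weak beta P gamma + rho)).

Definition is_MQDF_bound (R : realType) (alpha beta P R1 R2 v : R) : Prop :=
  is_max [set MQDF_rate alpha beta P R1 R2 gamma rho |
           gamma in `[0, 1] & rho in `[0, Num.min R1 R2]] v.

Definition cutset_sym (R : realType) (P Rbar : R) : R :=
  cutset 1 (-1) P Rbar Rbar.

Definition is_DF_bound_sym (R : realType) (P Rbar v : R) : Prop :=
  is_DF_bound 1 (-1) P Rbar Rbar v.

Definition is_MQDF_bound_sym (R : realType) (P Rbar v : R) : Prop :=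
  is_MQDF_bound 1 (-1) P Rbar Rbar v.

(* Main.v *)
(** At every power split gamma the two layers satisfy
    (1 + gamma P) (1 + (1 - gamma) P / (gamma P + 1)) = 1 + P,
    so psi (gamma P) + psi_weak gamma = psi P and the last term of both rates
    does not depend on gamma; at gamma = 0 the middle term is not binding.  For
    MQ-DF, the mean of the two terms that depend on rho is Rbar + psi P / 2,
    which rho = Rbar - psi P / 2 attains as soon as it is nonnegative. *)

Require Import Defs.
From mathcomp Require Import all_boot all_order all_algebra.
From mathcomp Require Import all_classical all_reals all_analysis.
From mathcomp Require Import ring lra.
Import Order.TTheory GRing.Theory Num.Theory.
Local Open Scope ring_scope.

Lemma log2M (R : realType) (x y : R) :
  0 < x -> 0 < y -> log2 (x * y) = log2 x + log2 y.
Proof. by move=> x0 y0; rewrite /log2 lnM ?posrE// mulrDl. Qed.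

Lemma psi_ge0 (R : realType) (x : R) : 0 <= x -> 0 <= psi x.
Proof.
move=> x0; rewrite /psi /log2 mulr_ge0 ?invr_ge0 ?ler0n// divr_ge0//.
  by rewrite ln_ge0// lerDl.
by rewrite ln_ge0// ler1n.
Qed.

Lemma psi_weak0 (R : realType) (beta P : R) :
  psi_weak beta P 0 = psi (beta ^+ 2 * P).
Proof. by rewrite /psi_weak subr0 !mul0r add0r divr1 mul1r. Qed.

Lemma psiD_psi_weak (R : realType) (beta P gamma : R) :
  0 <= P -> 0 <= gamma <= 1 ->
  psi (gamma * beta ^+ 2 * P) + psi_weak beta P gamma = psi (beta ^+ 2 * P).
Proof.
move=> P0 /andP[g0 g1].
have b0 : 0 <= beta ^+ 2 * P by rewrite mulr_ge0 ?sqr_ge0.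
have d0 : 0 < 1 + gamma * beta ^+ 2 * P.
  by rewrite ltr_pwDl// -mulrA mulr_ge0.
have dE : gamma * beta ^+ 2 * P + 1 = 1 + gamma * beta ^+ 2 * P by rewrite addrC.
rewrite /psi_weak dE /psi -mulrDr -log2M//; last first.
  rewrite ltr_pwDl// divr_ge0// ?(ltW d0)// -mulrA mulr_ge0//.
  by rewrite subr_ge0.
by congr (_ * log2 _); field; exact: lt0r_neq0.
Qed.

(** The gains 1 and -1 have equal squares, so both layers fit [psiD_psi_weak] and the sum of their
    rates collapses. *)
Lemma DF_rate_sym (R : realType) (P R1 R2 gamma : R) :
  0 <= P -> 0 <= gamma <= 1 ->
  DF_rate 1 (-1) P R1 R2 gamma =
    Num.min (R1 + R2) (Num.min (R1 + psi_weak (-1) P gamma) (psi P)).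
Proof.
move=> P0 hg; have := psiD_psi_weak _ (-1) _ _ P0 hg.
by rewrite /DF_rate sqrrN expr1n mul1r => ->.
Qed.

Lemma MQDF_rate_sym (R : realType) (P R1 R2 gamma rho : R) :
  0 <= P -> 0 <= gamma <= 1 ->
  MQDF_rate 1 (-1) P R1 R2 gamma rho =
    Num.min (R1 + R2 - rho)
      (Num.min (R1 + psi_weak (-1) P gamma) (psi P + rho)).
Proof.
move=> P0 hg; have := psiD_psi_weak _ (-1) _ _ P0 hg.
by rewrite /MQDF_rate sqrrN expr1n mul1r => ->.
Qed.

Theorem proposition4 (R : realType) (P Rbar : R)
    (hP : 0 < P) (hRbar : 0 < Rbar) :
  [/\ cutset_sym P Rbar =
        (if psi P < Rbar then Rbar + psi P else 2 * Rbar),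
      is_DF_bound_sym P Rbar
        (if psi P < 2 * Rbar then psi P else 2 * Rbar) &
      is_MQDF_bound_sym P Rbar
        (if psi P < 2 * Rbar then Rbar + psi P / 2 else 2 * Rbar)].
Proof.
have P0 := ltW hP.
have s0 := psi_ge0 _ _ P0.
have w0 : psi_weak (-1) P 0 = psi P by rewrite psi_weak0 sqrrN expr1n mul1r.
have g0 : 0 <= (0 : R) <= 1 by rewrite lexx ler01.
split.
- rewrite /cutset_sym /cutset sqrrN !expr1n mul1r minxx minElt ltrD2l.
  (* The minimum tests [Rbar < psi P], the statement [psi P < Rbar]; if both fail, the two are equal
     and the branches agree. *)
  by case: ltP => h1; case: ltP => h2; lra.
- split.
  + exists 0; first by rewrite /= in_itv.
    rewrite DF_rate_sym// w0 (@min_r _ _ (Rbar + psi P)); last by lra.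
    by have [h|h] := ltP (psi P) (2 * Rbar); [rewrite min_r | rewrite min_l]; lra.
  + move=> y [g]; rewrite /= in_itv /= => hg <-.
    rewrite DF_rate_sym// !ge_min.
    by case: ltP => _; apply/orP; [right; apply/orP; right | left]; lra.
- split.
  + exists 0; first by rewrite /= in_itv.
    (* The balancing [rho] is at most [Rbar] because [psi P] is nonnegative; where it would be
       negative, it is clipped to 0 and the sum rate is the smallest term. *)
    exists (if psi P < 2 * Rbar then Rbar - psi P / 2 else 0).
      by rewrite minxx /= in_itv /=; case: ltP => ?; apply/andP; split; lra.
    rewrite MQDF_rate_sym// w0.
    have [h|h] := ltP (psi P) (2 * Rbar).
      by rewrite (@min_r _ _ (Rbar + psi P)) ?min_l; lra.
    by rewrite min_l ?le_min; [|apply/andP; split]; lra.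
  + move=> y [g]; rewrite /= in_itv /= => hg [rho].
    rewrite minxx in_itv /= => /andP[r0 r1] <-.
    rewrite MQDF_rate_sym// !ge_min.
    case: ltP => h; last by apply/orP; left; lra.
    (* The two terms in [rho] add up to [2 * Rbar + psi P], so they cannot both exceed half of
       it. *)
    have [h1|h1] := leP (2 * Rbar - rho) (Rbar + psi P / 2).
      by apply/orP; left; lra.
    by apply/orP; right; apply/orP; right; lra.
Qed.
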